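(* Let $K$ be a knot with Alexander polynomial $\Delta_K(t)$, and let $\theta\in\mathbb{R}$. There exists a non-trivial coloring of a diagram of $K$ by $\mathrm{Rot}(\mathbb{E}^2)$ all of whose rotation angles equal $\theta$ (i.e. every arc receives a color of the form $(z,e^{\theta\sqrt{-1}})$) if and only if $\Delta_K(e^{\theta\sqrt{-1}})=0$. Consequently, $K$ is $\mathrm{Rot}(\mathbb{E}^2)$-colorable if and only if $\Delta_K(t)$ has a root on the unit circle in $\mathbb{C}$.
   Context: $\mathrm{Rot}(\mathbb{E}^2)$ denotes the quandle of all rotations of the Euclidean plane, identified with $\mathbb{C}\times \mathrm{U}(1)$ with binary operation $(z,e^{\theta\sqrt{-1}})\ast(w,e^{\eta\sqrt{-1}})=((z-w)e^{\eta\sqrt{-1}}+w,\;e^{\theta\sqrt{-1}})$; the element $(z,e^{\theta\sqrt{-1}})$ is the rotation about $z$ by angle $\theta$. A coloring of an oriented knot diagram $D$ by a quandle $X$ is a map from the set of arcs of $D$ to $X$ such that at every crossing with over arc colored $y$, incoming under arc colored $x$ and outgoing under arc colored $x'$, one has $x'=x\ast y$ if the crossing is positive and $x'\ast y=x$ if it is negative. A constant map is a coloring, called trivial. A knot is $X$-colorable if some diagram of it admits a non-trivial coloring by $X$ (this is independent of the diagram since colorings correspond bijectively under Reidemeister moves). *)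

(* Defs.v *)
From HB Require Import structures.
From mathcomp Require Import all_boot all_order all_algebra.
Set Implicit Arguments. Unset Strict Implicit. Unset Printing Implicit Defensive.
Import Order.TTheory GRing.Theory Num.Theory.

(* Oriented knot diagrams, encoded by signed Gauss codes.                    *)
(* A diagram with gd_n.+1 >= 1 crossings (crossings indexed by 'I_gd_n.+1)   *)
(* is given by the cyclic sequence of its 2*(gd_n.+1) passages through       *)
(* crossings, in the order met when travelling along the orientation; a      *)
(* passage is (crossing, true) if the strand passes OVER, (crossing, false)  *)
(* if it passes UNDER.  gd_sign c = true iff crossing c is positive.         *)
Record gauss_diagram := GaussDiagram {
  gd_n : nat;
  gd_code : seq ('I_gd_n.+1 * bool);
  gd_sign : 'I_gd_n.+1 -> bool
}.

Section Diagram.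
Variable D : gauss_diagram.
Local Notation N := (gd_n D).+1.
Local Notation crossing := 'I_N.
Local Notation code := (gd_code D).
Local Notation L := (N * 2)%N.

Definition passage_dflt : crossing * bool := (ord0, false).
Definition passage_at (p : nat) : crossing * bool := nth passage_dflt code (p %% L).
Definition pos_of (x : crossing * bool) : nat := index x code.

Definition gauss_code_ok : Prop :=
  size code = L /\ forall (c : crossing) (b : bool), count_mem (c, b) code = 1%N.

(* Ribbon-graph (4-valent) structure of the diagram.  A dart is a half-edge  *)
(* at a crossing: (c, over?, outgoing?).                                     *)
Definition dart := (crossing * bool * bool)%type.

(* edge involution: the outgoing half-edge of a passage is glued to the      *)
(* incoming half-edge of the next passage along the knot                     *)
Definition dart_alpha (d : dart) : dart :=
  let: (c, ov, outg) := d in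
  let p := pos_of (c, ov) in
  if outg then (passage_at p.+1, false) else (passage_at (p + L).-1, true).

(* counterclockwise rotation of the 4 half-edges around crossing c; it is   *)
(* determined by the sign of c (positive: over-out, under-out, over-in,      *)
(* under-in; negative: the mirror order)                                      *)
Definition dart_sigma (d : dart) : dart :=
  let: (c, ov, outg) := d in
  if @gd_sign D c then
    match ov, outg with
    | true, true => (c, false, true)
    | false, true => (c, true, false)
    | true, false => (c, false, false)
    | false, false => (c, true, true)
    end
  else
    match ov, outg with
    | true, true => (c, false, false)
    | false, false => (c, true, false)
    | true, false => (c, false, true)
    | false, true => (c, true, true)
    end.

Definition dart_face_step (d : dart) : dart := dart_sigma (dart_alpha d).

Definition n_faces : nat := fcard dart_face_step (@predT dart).

(* the Gauss code is realised by a diagram in the plane (= the sphere):     *)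
(* Euler's formula V - E + F = 2 with V = N, E = 2N                          *)
Definition planar : Prop := n_faces = (N + 2)%N.

Definition knot_diagram : Prop := gauss_code_ok /\ planar.

(* Arcs.  Arcs go from an under-passage to the next under-passage; the arc  *)
(* starting at the under-passage of crossing c is indexed by c itself, so    *)
(* arcs are indexed by 'I_N as well.                                         *)
(* prev_under p = the crossing of the last under-passage strictly before     *)
(* position p (cyclically), i.e. the arc the strand is on just before p.     *)
Definition prev_under (p : nat) : crossing :=
  let ks := [seq (p + L - k)%N | k <- iota 1 L] in
  (passage_at (nth 0%N ks (find (fun q => ~~ (passage_at q).2) ks))).1.

Definition knot_arc := crossing.
Definition under_in_arc (c : crossing) : knot_arc := prev_under (pos_of (c, false)).
Definition under_out_arc (c : crossing) : knot_arc := c.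
Definition over_arc (c : crossing) : knot_arc := prev_under (pos_of (c, true)).

Local Open Scope ring_scope.
Definition alexander_matrix : 'M[{poly int}]_N :=
  \matrix_(x < N, a < N)
    if @gd_sign D x then
      (a == under_in_arc x)%:R * 'X + (a == over_arc x)%:R * (1 - 'X)
        - (a == under_out_arc x)%:R
    else
      (a == under_out_arc x)%:R * 'X + (a == over_arc x)%:R * (1 - 'X)
        - (a == under_in_arc x)%:R.

(* Alexander polynomial: determinant of the first minor of the Alexander    *)
(* matrix (defined up to multiplication by units +- t^k)                     *)
Definition alexander_poly : {poly int} :=
  \det (\matrix_(i < gd_n D, j < gd_n D)
          alexander_matrix (lift ord0 i) (lift ord0 j)).

End Diagram.
Local Open Scope ring_scope.

Definition alexander_eval (C : numClosedFieldType) (D : gauss_diagram) (u : C) : C :=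
  (map_poly (fun z : int => z%:~R) (alexander_poly D)).[u].

Local Open Scope ring_scope.
Definition in_rot (C : numClosedFieldType) (x : C * C) : Prop := `|x.2| = 1.

Definition rot_op (C : numClosedFieldType) (x y : C * C) : C * C :=
  ((x.1 - y.1) * y.2 + y.1, x.2).

Definition rot_coloring (C : numClosedFieldType) (D : gauss_diagram)
    (col : knot_arc D -> C * C) : Prop :=
  (forall a, in_rot (col a)) /\
  (forall x : 'I_(gd_n D).+1,
     if @gd_sign D x then
       col (under_out_arc x) = rot_op (col (under_in_arc x)) (col (over_arc x))
     else
       rot_op (col (under_out_arc x)) (col (over_arc x)) = col (under_in_arc x)).

Definition nontrivial_coloring (C : numClosedFieldType) (D : gauss_diagram)
    (col : knot_arc D -> C * C) : Prop :=
  exists a b, col a <> col b.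

(* Main.v *)
(* The coordinates of the centers turn the colorings of angle theta into the  *)
(* kernel of the Alexander matrix at u = e^(i theta), which always contains   *)
(* the constants. A non-constant kernel vector, shifted to vanish at the arc  *)
(* 0, is a kernel vector of the first minor. Conversely, a kernel vector of   *)
(* the minor satisfies all crossing relations but one, and the last one       *)
(* follows from the others: weighting each edge by u^n, for an Alexander      *)
(* numbering n of the faces, makes the relations add up to zero. This is      *)
(* where planarity enters, since the numbering exists by Euler's formula.     *)
(* Finally, angles are preserved under crossings, hence constant on a knot.   *)
Require Import Defs.
From HB Require Import structures.
From mathcomp Require Import all_boot all_order all_algebra.
From mathcomp Require Import ring zify.
Set Implicit Arguments. Unset Strict Implicit. Unset Printing Implicit Defensive.
Import Order.TTheory GRing.Theory Num.Theory.
Local Open Scope ring_scope.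

(** For a fixed angle, [rot_coloring_defect] turns the question into linear algebra on the centers,
    settled by [nonconst_defect0]. The hard input is [crossing_defect_relation]: one dependency with
    nonzero weights among the crossing relations. Its weights are signed powers of [u], so integer
    exponents are needed, from [alexander_numbering]; these come from a rational potential on the
    faces, obtained by a dimension count in [face_potential]. [rot_coloring_angle] reduces arbitrary
    colorings to a fixed angle. *)

(** * Orbits and linear algebra *)

Lemma fcard_labelling (T : finType) (f : T -> T) : injective f ->
  exists k : T -> 'I_(fcard f (@predT T)),
    (forall y, k (f y) = k y) /\ (forall i, exists y, k y = i).
Proof.
move=> injf; rewrite /n_comp_mem; set A := predI _ _.
have Ar y : froot f y \in A by rewrite !inE /= (roots_root (fconnect_sym injf)).
have lt y : (index (froot f y) (enum A) < #|A|)%N.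
  by rewrite cardE index_mem mem_enum Ar.
exists (fun y => Ordinal (lt y)); split=> [y | i].
  apply/val_inj => /=; congr index; apply/esym/eqP.
  by rewrite (root_connect (fconnect_sym injf)) fconnect1.
exists (enum_val i); apply/val_inj => /=.
have: enum_val i \in A by exact: enum_valP.
rewrite !inE /= andbT => /eqP ->.
by rewrite (enum_val_nth (enum_val i)) index_uniq ?enum_uniq // -cardE.
Qed.

(** Rank-nullity: a left kernel of dimension at most 1 forces rank [m]. *)
Lemma const_ker_surj (F : fieldType) m (M : 'M[F]_(m.+1, m)) :
  (forall x : 'rV_m.+1, x *m M = 0 -> exists c, x = const_mx c) ->
  forall y : 'rV_m, exists x, x *m M = y.
Proof.
move=> kerM y.
have ker1 : (kermx M <= (const_mx 1 : 'rV[F]_m.+1))%MS.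
  apply/row_subP => i.
  have [c ->] := kerM (row i (kermx M)) ltac:(by rewrite -row_mul mulmx_ker row0).
  apply/submxP; exists c%:M; apply/rowP => j.
  by rewrite mul_scalar_mx !mxE mulr1.
have rkM : row_full M.
  have := mxrankS ker1; rewrite mxrank_ker => rk.
  have := rank_leq_row (const_mx 1 : 'rV[F]_m.+1).
  have := rank_leq_col M; rewrite /row_full; lia.
have /submxP[x ->] : (y <= M)%MS by rewrite submx_full.
by exists x.
Qed.

Lemma sum_delta (R : pzRingType) n (x : 'I_n -> R) a :
  \sum_i x i * (i == a)%:R = x a.
Proof.
rewrite (bigD1 a) //= eqxx mulr1 big1 ?addr0 // => i /negbTE ->.
by rewrite mulr0.
Qed.

(** * Gauss codes and darts *)

Section Diagram.
Variable D : gauss_diagram.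
Local Notation N := (gd_n D).+1.
Local Notation L := (N * 2)%N.
Hypothesis codeD : gauss_code_ok D.

Lemma mem_gd_code x : x \in gd_code D.
Proof. by case: x => c b; rewrite -has_pred1 has_count (codeD.2 c b). Qed.

Lemma uniq_gd_code : uniq (gd_code D).
Proof.
by apply: count_mem_uniq => -[c b]; rewrite (codeD.2 c b) mem_gd_code.
Qed.

Lemma pos_of_lt x : (@pos_of D x < L)%N.
Proof. by rewrite -codeD.1 index_mem mem_gd_code. Qed.

Lemma pos_ofK x : passage_at D (pos_of x) = x.
Proof. by rewrite /passage_at modn_small ?pos_of_lt // nth_index ?mem_gd_code. Qed.

Lemma passage_atK p : pos_of (passage_at D p) = (p %% L)%N.
Proof.
by rewrite /pos_of index_uniq ?uniq_gd_code // codeD.1 ltn_pmod.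
Qed.

Lemma eq_passage_at p q : (p = q %[mod L])%N -> passage_at D p = passage_at D q.
Proof. by rewrite /passage_at => ->. Qed.

Lemma modn_predS p : (((p + L).-1 %% L).+1 = p %[mod L])%N.
Proof. by rewrite -addn1 modnDml addn1 prednK ?addn_gt0 ?orbT // modnDr. Qed.

Lemma modn_Spred p : (((p.+1 %% L) + L).-1 = p %[mod L])%N.
Proof.
have -> : ((p.+1 %% L + L).-1 = p.+1 %% L + L.-1)%N by lia.
by rewrite modnDml (_ : (p.+1 + L.-1 = p + L)%N) ?modnDr //; lia.
Qed.

Definition prev_passage x := passage_at D (@pos_of D x + L).-1.

Lemma prev_passage_inj : injective prev_passage.
Proof.
apply: (can_inj (g := fun x => passage_at D (@pos_of D x).+1)) => x.
rewrite /prev_passage passage_atK.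
by rewrite (eq_passage_at (modn_predS _)) pos_ofK.
Qed.

Lemma dart_alpha_out x :
  dart_alpha (x, true) = (passage_at D (pos_of x).+1, false).
Proof. by case: x. Qed.

Lemma dart_alpha_in x : dart_alpha (x, false) = (prev_passage x, true).
Proof. by case: x. Qed.

Lemma dart_alpha_passage p :
  dart_alpha (passage_at D p, true) = (passage_at D p.+1, false).
Proof.
rewrite dart_alpha_out passage_atK; congr (_, _); apply: eq_passage_at.
by rewrite -addn1 modnDml addn1.
Qed.

Lemma dart_alphaK : involutive (@dart_alpha D).
Proof.
case=> x []; last first.
  by rewrite dart_alpha_in dart_alpha_passage prednK ?addn_gt0 ?orbT //
    (@eq_passage_at _ (pos_of x)) ?pos_ofK // modnDr.
rewrite dart_alpha_out dart_alpha_in /prev_passage passage_atK.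
by rewrite (eq_passage_at (modn_Spred _)) pos_ofK.
Qed.

Lemma dart_sigma_inj : injective (@dart_sigma D).
Proof.
apply: (can_inj (g := fun d => dart_sigma (dart_sigma (dart_sigma d)))) => d.
by case: d => [[c b] o]; case E: (gd_sign c); case: b; case: o; do 4!rewrite /= E.
Qed.

Lemma dart_face_step_inj : injective (@dart_face_step D).
Proof.
by move=> d d' /dart_sigma_inj /(inv_inj dart_alphaK).
Qed.

(** * Connectedness and the numbering of the faces *)

(** A knot has one component: its single cyclic code visits every passage. *)
Lemma passage_succ_const (T : Type) (f : 'I_N * bool -> T) :
    (forall p, f (passage_at D p.+1) = f (passage_at D p)) ->
  forall x, f x = f (passage_at D 0).
Proof.
move=> fS x; rewrite -(pos_ofK x).
by elim: (pos_of x) => // p <-.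
Qed.

Lemma dart_connected (T : Type) (f : dart D -> T) :
    (forall d, f (dart_alpha d) = f d) -> (forall d, f (dart_sigma d) = f d) ->
  forall d d', f d = f d'.
Proof.
move=> fa fs.
have f_in x : f (x, false) = f (x, true).
  rewrite -(fs (x, false)) -fs; case: x => c b /=.
  by case E: (gd_sign c); case: b; rewrite /= !E.
have f_const x : f (x, true) = f (passage_at D 0, true).
  apply: (passage_succ_const (f := fun x => f (x, true))) => p.
  by rewrite -f_in -dart_alpha_passage fa.
suff fc d : f d = f (passage_at D 0, true) by move=> d d'; rewrite fc (fc d').
by case: d => x []; rewrite ?f_in f_const.
Qed.

(* [T x] is the flow on edges given by the jumps of the face function [x]. It *)
(* is conserved at crossings, so following the knot it is determined by its   *)
(* value at one edge and its N jumps at over-passages; since [T] kills only   *)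
(* the constants and there are N + 2 faces, all those N + 1 values are        *)
(* attained. Zero jumps and value 1 give the unit flow along the knot.        *)
Lemma face_potential : planar D ->
  exists f : dart D -> rat,
    (forall d, f (dart_face_step d) = f d) /\
    (forall x, f (x, true) = f (dart_alpha (x, true)) + 1).
Proof.
(* Faces are the orbits of [dart_face_step]; [k d] and [k (dart_alpha d)] are the faces on the two
   sides of the edge of [d]. *)
have [k []] := fcard_labelling dart_face_step_inj.
rewrite /planar /n_faces => + + planarD; move: k; rewrite planarD addn2.
move=> k kf ks.
have ka d : k (dart_alpha d) = k (dart_sigma d).
  by rewrite -kf /dart_face_step dart_alphaK.
pose T (x : 'rV[rat]_N.+2) d := x 0 (k d) - x 0 (k (dart_alpha d)).
have Ta x d : T x (dart_alpha d) = - T x d.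
  by rewrite /T dart_alphaK opprB.
(* By [ka], [T x d] compares [d] with [dart_sigma d], so the four values around a crossing telescope
   to zero. *)
have Tflow x c : T x (c, true, true) + T x (c, true, false) =
    - (T x (c, false, true) + T x (c, false, false)).
  by rewrite /T !ka /=; case: (gd_sign c); ring.
have Tconst x : (forall c, T x (c, true, true) + T x (c, true, false) = 0) ->
    forall y, T x (y, true) = T x (passage_at D 0, true).
  move=> Tx0; apply: (passage_succ_const (f := fun y => T x (y, true))) => p.
  apply: oppr_inj; rewrite -[RHS]Ta dart_alpha_passage.
  case: (passage_at D p.+1) => c b; apply/esym/eqP; rewrite -addr_eq0 addrC.
  by case: b; rewrite ?Tx0 // -oppr_eq0 -Tflow Tx0.
pose del i d : rat := (i == k d)%:R - (i == k (dart_alpha d))%:R.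
pose M := \matrix_(i < N.+2, j < N.+1)
  if unlift ord0 j is Some c then del i (c, true, true) + del i (c, true, false)
  else del i (passage_at D 0, true).
have sum_del (x : 'rV[rat]_N.+2) d : \sum_i x 0 i * del i d = T x d.
  by rewrite /del /T; under eq_bigr do rewrite mulrBr; rewrite sumrB !sum_delta.
have xM (x : 'rV[rat]_N.+2) j : (x *m M) 0 j =
    if unlift ord0 j is Some c then T x (c, true, true) + T x (c, true, false)
    else T x (passage_at D 0, true).
  rewrite mxE; under eq_bigr do rewrite mxE.
  case: (unlift ord0 j) => [c|]; last exact: sum_del.
  by under eq_bigr do rewrite mulrDr; rewrite big_split /= !sum_del.
have kerM (x : 'rV[rat]_N.+2) : x *m M = 0 -> exists c, x = const_mx c.
  move=> xM0.
  have Tx0 c : T x (c, true, true) + T x (c, true, false) = 0.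
    by have := xM x (lift ord0 c); rewrite xM0 mxE liftK.
  have Tx : T x (passage_at D 0, true) = 0.
    by have := xM x ord0; rewrite xM0 mxE unlift_none.
  have xa d : x 0 (k (dart_alpha d)) = x 0 (k d).
    suff: T x d = 0 by move/subr0_eq.
    case: d => y []; first by rewrite Tconst.
    by apply: oppr_inj; rewrite -Ta dart_alpha_in Tconst // Tx oppr0.
  exists (x 0 (k (passage_at D 0, true))); apply/rowP => i.
  have [d <-] := ks i; rewrite mxE.
  apply: (dart_connected (f := fun d => x 0 (k d))) => {}d //.
  by rewrite -ka.
have [x xE] := const_ker_surj kerM (delta_mx 0 ord0).
exists (fun d => x 0 (k d)); split=> [d | y]; first by rewrite kf.
suff: T x (y, true) = 1 by rewrite /T => /eqP; rewrite subr_eq addrC => /eqP.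
rewrite Tconst => [|c].
  by have := xM x ord0; rewrite xE !mxE unlift_none.
by have := xM x (lift ord0 c); rewrite xE !mxE liftK.
Qed.

(** Taking floors commutes with adding 1, so the rational potential becomes an integral one with the
    same unit jumps. *)
Lemma alexander_numbering : planar D ->
  exists n : dart D -> int,
    (forall d, n (dart_face_step d) = n d) /\
    (forall x, n (x, true) = n (dart_alpha (x, true)) + 1).
Proof.
case/face_potential => f [ff fa]; exists (fun d => Num.floor (f d)).
by split=> [d | x]; [rewrite ff | rewrite fa floorDrz ?rpred1 // floor1].
Qed.

(** * Arcs *)

(* [k] is the number of over-passages since the last under-passage; the index *)
(* is shifted by [L] as in [prev_under] to stay clear of truncation.          *)
Lemma prev_underE p k : (k < L)%N -> ~~ (passage_at D (p + L - k.+1)).2 ->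
    (forall j, (j < k)%N -> (passage_at D (p + L - j.+1)).2) ->
  prev_under D p = (passage_at D (p + L - k.+1)).1.
Proof.
move=> kL uk oj; rewrite /prev_under.
set ks := map _ _; set a := fun q => _.
have szk : size ks = L by rewrite size_map size_iota.
have nthk j : (j < L)%N -> nth 0%N ks j = (p + L - j.+1)%N.
  by move=> jL; rewrite (nth_map 0%N) ?size_iota // nth_iota // add1n.
suff -> : find a ks = k by rewrite nthk.
case: findP => [/hasPn noa | i iL ai aj].
  have /noa : nth 0%N ks k \in ks by rewrite mem_nth ?szk.
  by rewrite nthk // /a uk.
rewrite szk in iL; case: (ltngtP i k) => // [ik | ki].
  by have := ai 0%N; rewrite nthk // /a oj.
by have := aj 0%N k ki; rewrite nthk // /a uk.
Qed.

Lemma prev_underP p : exists k, [/\ (k < L)%N,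
  ~~ (passage_at D (p + L - k.+1)).2 &
  forall j, (j < k)%N -> (passage_at D (p + L - j.+1)).2].
Proof.
have ex : exists k, (k < L)%N && ~~ (passage_at D (p + L - k.+1)).2.
  pose q := @pos_of D (ord0, false).
  (* This many steps plus one, backwards from [p], lead to [q] modulo [L]. *)
  exists ((p + L - q.+1) %% L)%N; rewrite ltn_pmod //=.
  suff -> : passage_at D (p + L - ((p + L - q.+1) %% L).+1) = (ord0, false) by [].
  rewrite -[RHS]pos_ofK -/q; apply: eq_passage_at.
  have qL : (q < L)%N by exact: pos_of_lt.
  have rL : ((p + L - q.+1) %% L < L)%N by rewrite ltn_pmod.
  rewrite (_ : (p + L - _ = (p + L - q.+1) %/ L * L + q)%N) ?modnMDl //.
  by have := divn_eq (p + L - q.+1) L; lia.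
exists (ex_minn ex); case: ex_minnP => k /andP[kL uk] kmin; split=> // j jk.
apply: contraT => uj; have := kmin j.
by rewrite uj (ltn_trans jk kL) leqNgt jk => /(_ isT).
Qed.

Lemma eq_prev_under p q : (p = q %[mod L])%N -> prev_under D p = prev_under D q.
Proof.
move=> pq; have [k [kL uk oj]] := prev_underP p.
have E j : (j < L)%N -> passage_at D (p + L - j.+1) = passage_at D (q + L - j.+1).
  move=> jL; apply: eq_passage_at.
  have E r : (r + L - j.+1 = r + (L - j.+1))%N by lia.
  by rewrite !E -modnDml pq modnDml.
rewrite (prev_underE kL uk oj) E // (@prev_underE q k) // -?E // => j jk.
by rewrite -E ?oj //; exact: ltn_trans jk kL.
Qed.

Lemma prev_underS p : prev_under D p.+1 =
  if (passage_at D p).2 then prev_under D p else (passage_at D p).1.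
Proof.
have EpS j : passage_at D (p.+1 + L - j.+1) = passage_at D (p + L - j) by [].
have E0 : passage_at D (p + L) = passage_at D p.
  by apply: eq_passage_at; rewrite modnDr.
case: ifPn => [op | up]; last first.
  by rewrite (@prev_underE _ 0) // EpS subn0 E0.
have [k [kL uk oj]] := prev_underP p.
case: (ltnP k.+1 L) => [kL' | Lk].
  rewrite (prev_underE kL uk oj) (@prev_underE _ k.+1) // => -[|j] jk.
    by rewrite EpS subn0 E0.
  by rewrite EpS oj.
(* Here [k.+1 = L], so the under-passage found would be at [p] itself, against [op]. *)
by move: uk; rewrite (_ : k.+1 = L) ?addnK ?op //; apply/eqP; rewrite eqn_leq kL.
Qed.

(** Travelling along the knot meets every arc, and the arc changes only at under-passages. *)
Lemma under_in_arc_const (T : Type) (g : knot_arc D -> T) :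
  (forall c, g (under_out_arc c) = g (under_in_arc c)) ->
  forall a b, g a = g b.
Proof.
move=> gS.
have GS p : g (prev_under D p.+1) = g (prev_under D p).
  rewrite prev_underS; case E: (passage_at D p) => [c []] //=.
  rewrite [LHS]gS /under_in_arc -E passage_atK; congr g.
  by apply: eq_prev_under; rewrite modn_mod.
have G0 p : g (prev_under D p) = g (prev_under D 0) by elim: p => // p <-.
suff gc a : g a = g (prev_under D 0) by move=> a b; rewrite gc (gc b).
by rewrite -(G0 (@pos_of D (a, false)).+1) prev_underS pos_ofK.
Qed.

(** * The dependency between the crossing relations *)

Section Alexander.
Variables (C : fieldType) (u : C).

(** Row [c] of the Alexander matrix at [u], applied to [z]. *)
Definition crossing_defect (z : knot_arc D -> C) (c : 'I_N) : C :=
  if gd_sign c then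
    z (under_in_arc c) * u + z (over_arc c) * (1 - u) - z (under_out_arc c)
  else
    z (under_out_arc c) * u + z (over_arc c) * (1 - u) - z (under_in_arc c).

Lemma crossing_defect_relation : u != 0 -> planar D ->
  exists w : 'I_N -> C, (forall c, w c != 0) /\
    forall z, \sum_c w c * crossing_defect z c = 0.
Proof.
move=> u0 /alexander_numbering [n [nf nout]].
have na d : n (dart_alpha d) = n (dart_sigma d).
  by rewrite -nf /dart_face_step dart_alphaK.
have nin x : n (x, false) + 1 = n (dart_alpha (x, false)).
  by rewrite dart_alpha_in nout -dart_alpha_in dart_alphaK.
exists (fun c => if gd_sign c then u ^ n (c, false, true)
                 else - u ^ n (c, true, true)).
split=> [c | z]; first by case: ifP; rewrite ?oppr_eq0 expfz_neq0.
(* The weighted value on the edge leaving [x]. Each edge leaves one passage and enters the next, so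
   incoming minus outgoing sums to zero; grouped by crossing, the four terms give the weighted
   defect. *)
pose E x := u ^ n (x, true) * z (prev_under D (pos_of x).+1).
have Eprev x : E (prev_passage x) = u ^ (n (x, false) + 1) * z (prev_under D (pos_of x)).
  rewrite nin dart_alpha_in /E; congr (_ * z _).
  apply: eq_prev_under; rewrite /prev_passage passage_atK; exact: modn_predS.
have EN c b : E (c, b) = u ^ n (c, b, true) *
    z (if b then over_arc c else under_out_arc c).
  by rewrite /E prev_underS pos_ofK /=; case: b.
have E0 : \sum_x (E (prev_passage x) - E x) = 0.
  by rewrite sumrB [X in X - _ = _]
    (_ : _ = \sum_x E x) ?subrr // [RHS](reindex_inj prev_passage_inj).
transitivity (\sum_c \sum_b (E (prev_passage (c, b)) - E (c, b))); last first.
  by rewrite pair_bigA -[RHS]E0; apply: eq_bigr => -[].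
apply: eq_bigr => c _; rewrite big_bool /= !Eprev !EN /crossing_defect.
rewrite -/(over_arc c) -/(under_in_arc c).
move: (nout (c, true)) (nout (c, false)) (nin (c, true)) (nin (c, false)).
rewrite !na /=; case: (gd_sign c) => nOo nUo nOi nUi.
  by rewrite -nUo nUi nOo exprzDr ?unitfE // expr1z; ring.
by rewrite nOi -nOo nUo exprzDr ?unitfE // expr1z; ring.
Qed.
End Alexander.

(** * The determinant and the colorings *)

Section Coloring.
Variables (C : numClosedFieldType) (u : C).

Let ev : {rmorphism {poly int} -> C} := horner_eval u \o map_poly intr.

Lemma alexander_evalE :
  alexander_eval D u = \det (\matrix_(i < gd_n D, j < gd_n D)
    ev (alexander_matrix D (lift ord0 i) (lift ord0 j))).
Proof.
rewrite -[LHS]/(ev _) /alexander_poly -det_map_mx; congr (\det _).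
by apply/matrixP => i j; rewrite !mxE.
Qed.

Lemma ev_alexander_matrix (z : knot_arc D -> C) c :
  \sum_a z a * ev (alexander_matrix D c a) = crossing_defect u z c.
Proof.
have evX : ev 'X = u by rewrite /ev /= map_polyX /horner_eval hornerX.
have sumE v w t (x y r : knot_arc D) :
    \sum_a z a * ((a == x)%:R * v + (a == y)%:R * w - (a == r)%:R * t) =
    z x * v + z y * w - z r * t.
  under eq_bigr do rewrite mulrBr mulrDr !mulrA.
  by rewrite sumrB big_split /= -!mulr_suml !sum_delta.
rewrite /crossing_defect; case: ifP => sc;
  rewrite -[z _ in X in _ - X]mulr1 -sumE; apply: eq_bigr => a _;
  by rewrite mxE sc rmorphB rmorphD !rmorphM rmorphB !rmorph_nat rmorph1 evX mulr1.
Qed.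

Lemma nonconst_defect0 : u != 0 -> planar D ->
  (exists z : knot_arc D -> C,
     (forall c, crossing_defect u z c = 0) /\ exists a b, z a <> z b)
  <-> alexander_eval D u = 0.
Proof.
move=> u0 planarD; rewrite alexander_evalE -det_tr; set B := (X in \det X).
(* [v] is extended by 0 at the arc [ord0]; [B] is the transposed minor because [v] acts from the
   left. *)
have BE (v : 'rV_(gd_n D)) i : (v *m B) 0 i =
    crossing_defect u (fun a => oapp (v 0) 0 (unlift ord0 a)) (lift ord0 i).
  rewrite -ev_alexander_matrix mxE big_ord_recl unlift_none /= mul0r add0r.
  by apply: eq_bigr => j _; rewrite !mxE liftK.
split=> [[z [z0 [a [b zab]]]] | /eqP/det0P [v v0 vB]].
  apply/eqP/det0P; exists (\row_j (z (lift ord0 j) - z ord0)).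
    apply/eqP => /rowP v0; case: zab.
    suff zc x : z x = z ord0 by rewrite !zc.
    case: (unliftP ord0 x) => [j|] -> //.
    by apply/eqP; rewrite -subr_eq0; have := v0 j; rewrite !mxE => ->.
  apply/rowP => i; rewrite BE !mxE -[RHS](z0 (lift ord0 i)).
  have zE x : oapp ((\row_j (z (lift ord0 j) - z ord0)) 0) 0 (unlift ord0 x) =
      z x - z ord0.
    by case: (unliftP ord0 x) => [j|] -> //=; rewrite ?mxE ?subrr.
  by rewrite /crossing_defect !zE; case: ifP => _; ring.
pose z (a : knot_arc D) := oapp (v 0) 0 (unlift ord0 a).
have zl i : crossing_defect u z (lift ord0 i) = 0 by rewrite -BE vB mxE.
exists z; split=> [c|].
  case: (unliftP ord0 c) => [i|] -> //.
  (* Only the relation at crossing [ord0] remains; its weight is nonzero and all other terms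
     vanish. *)
  have [w [w0 /(_ z)]] := crossing_defect_relation u0 planarD.
  rewrite big_ord_recl big1 ?addr0 => [/eqP|i _]; last by rewrite zl mulr0.
  by rewrite mulf_eq0 (negbTE (w0 _)) => /eqP.
have [i vi] := rV0Pn _ v0.
exists (lift ord0 i), ord0; rewrite /z liftK unlift_none /=; exact/eqP.
Qed.

(** With a common angle [u], [rot_op] acts on centers as the Alexander quandle:
    [x * u + y * (1 - u)]. *)
Lemma rot_coloring_defect (col : knot_arc D -> C * C) :
    `|u| = 1 -> (forall a, (col a).2 = u) ->
  rot_coloring col <-> forall c, crossing_defect u (fun a => (col a).1) c = 0.
Proof.
move=> u1 colu.
rewrite /rot_coloring /crossing_defect /rot_op; split=> [[_ colP] c | z0].
  have := colP c; case: ifP => _; rewrite !colu.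
    by move=> ->; rewrite /=; ring.
  by move=> <-; rewrite /=; ring.
split=> [a | c]; first by rewrite /in_rot colu.
have := z0 c; case: ifP => _ /eqP; rewrite subr_eq0 => /eqP zE.
  by rewrite !colu [LHS]surjective_pairing colu -zE; congr (_, _); ring.
by rewrite !colu [RHS]surjective_pairing colu -zE; congr (_, _); ring.
Qed.

End Coloring.

Lemma rot_coloring_angle (C : numClosedFieldType) (col : knot_arc D -> C * C) :
  rot_coloring col -> forall a b, (col a).2 = (col b).2.
Proof.
case=> _ colP; apply: (under_in_arc_const (g := fun a => (col a).2)) => c.
by have := colP c; case: ifP => _; [move=> -> | move=> <-].
Qed.

Lemma rot_coloring_alexander (C : numClosedFieldType) (u : C) :
    planar D -> `|u| = 1 ->
  (exists col : knot_arc D -> C * C,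
     [/\ rot_coloring col, nontrivial_coloring col & forall a, (col a).2 = u])
  <-> alexander_eval D u = 0.
Proof.
move=> planarD u1.
have u0 : u != 0 by rewrite -normr_eq0 u1 oner_eq0.
rewrite -(nonconst_defect0 u0 planarD).
split=> [[col [colP [a [b ab]] colu]] | [z [z0 [a [b ab]]]]].
  exists (fun a => (col a).1); split; first exact/rot_coloring_defect.
  exists a, b => eab; apply: ab.
  by rewrite [LHS]surjective_pairing [RHS]surjective_pairing eab !colu.
exists (fun a => (z a, u)); split=> //; first exact/(rot_coloring_defect u1).
by exists a, b => -[].
Qed.
End Diagram.

Theorem mainTheorem2 (C : numClosedFieldType) (D : gauss_diagram) :
  knot_diagram D ->
  (forall u : C, `|u| = 1 ->
     ((exists col : knot_arc D -> C * C,
         [/\ rot_coloring col, nontrivial_coloring col & forall a, (col a).2 = u])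
      <-> alexander_eval D u = 0))
  /\
  ((exists col : knot_arc D -> C * C, rot_coloring col /\ nontrivial_coloring col)
   <-> exists u : C, `|u| = 1 /\ alexander_eval D u = 0).
Proof.
case=> codeD planarD; have main := rot_coloring_alexander codeD planarD.
split=> [u /main // |]; split=> [[col [colP ncol]] | [u [u1 /(main _ _ u1)]]].
  have u1 := colP.1 ord0; exists (col ord0).2; split=> //.
  apply/(main _ _ u1); exists col; split=> // a.
  exact: (rot_coloring_angle codeD colP).
by case=> col [colP ncol _]; exists col.
Qed.
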